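(* For every integer $m\ge2$, $\Lambda(\mathcal P_m^\star)=\frac13-\frac1{3m^2}$. The unique maximizer (of $\lambda_{\mathcal P_m^\star}$ over the probability vectors on the $m$ colors) is the uniform probability vector.
   Context: A palette is a pair $\mathcal P=(\mathcal C,\mathcal A)$ where $\mathcal C$ is a finite set of colors and $\mathcal A\subseteq\mathcal C^3$ (repeated colors allowed). Its Lagrangian polynomial is $\lambda_{\mathcal P}(\mathbf x)=\sum_{(i,j,k)\in\mathcal A}x_ix_jx_k$ for $\mathbf x=(x_i)_{i\in\mathcal C}$, and its Lagrangian $\Lambda(\mathcal P)$ is the maximum of $\lambda_{\mathcal P}(\mathbf x)$ subject to $\sum_{i\in\mathcal C}x_i=1$ and $x_i\in[0,1]$ for all $i$. $\overrightarrow{\mathcal F}_{m,2}$ is the ordered digon chain on $m$ linearly ordered vertices: the vertices are split into consecutive blocks of size $2$ (with a final block of size $1$ if $m$ is odd), both arcs are present between the two vertices of each 2-element block, and for every pair of vertices in different blocks exactly the one arc from the earlier block to the later block is present. $\mathcal P_m^\star$ is the palette whose colors are the $m$ vertices of $\overrightarrow{\mathcal F}_{m,2}$ and in which $(x,y,z)$ is admissible iff $yx$ and $yz$ are both arcs of $\overrightarrow{\mathcal F}_{m,2}$ ($x=z$ allowed). *)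

(* Defs.v *)
From mathcomp Require Import all_boot all_order all_algebra.
From mathcomp Require Import classical_sets reals.

Set Implicit Arguments.
Unset Strict Implicit.
Unset Printing Implicit Defensive.

Import Order.TTheory GRing.Theory Num.Theory.

Local Open Scope ring_scope.
Local Open Scope classical_set_scope.

Record palette := Palette {
  color : finType;
  admissible : {set color * color * color} }.

Definition lagrangian_poly (R : realType) (P : palette)
    (x : {ffun color P -> R}) : R :=
  \sum_(t in admissible P) x t.1.1 * x t.1.2 * x t.2.

Definition prob_vector (R : realType) (C : finType) : set {ffun C -> R} :=
  [set x | \sum_i x i = 1 /\ forall i, 0 <= x i <= 1].

Definition is_maximum (R : realType) (S : set R) (v : R) : Prop :=
  S v /\ ubound S v.

(* The default value 0 of [xget] is only used when there is no maximum, which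
   by compactness happens only for the palette with no color. *)
Definition lagrangian (R : realType) (P : palette) : R :=
  xget 0 [set v | is_maximum
    [set lagrangian_poly x | x in @prob_vector R (color P)] v].

Definition is_maximizer (R : realType) (P : palette)
    (x : {ffun color P -> R}) : Prop :=
  prob_vector x /\
  forall y : {ffun color P -> R},
    prob_vector y -> lagrangian_poly y <= lagrangian_poly x.

(* Vertices are numbered from 0, so that the block of [u] is [u./2]; when [m]
   is odd the last block is the singleton {m-1}. *)
Definition digon_chain (m : nat) : rel 'I_m :=
  fun u v => ((u./2 == v./2) && (u != v)) || (u./2 < v./2)%N.

(* In a triple (x, y, z), encoded as ((x, y), z), both arcs start at the
   middle color y. *)
Definition palette_star (m : nat) : palette :=
  @Palette 'I_m [set t | digon_chain t.1.2 t.1.1 & digon_chain t.1.2 t.2].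

(* Main.v *)
(** Write [d u] for the total weight of the out-neighbours of [u], so that the
    Lagrangian polynomial is [\sum_u x u * d u ^ 2].  Peeling off the first
    block, of weights [a] and [b], from a chain of remaining weight [T] gives
    [3 (a (b + T)^2 + b (a + T)^2) + a^3 + b^3 + 3 T (a - b)^2
      = (a + b + T)^3 - T^3],
    which telescopes to [3 lambda(x) + \sum_u x_u^3 <= (\sum_u x_u)^3], with
    equality when [x] is constant.  On probability vectors [\sum_u x_u^3] is
    at least [1 / m^2], with equality only for the uniform vector, because the
    cube lies above its tangent at [1 / m]. *)
Require Import Defs.
From mathcomp Require Import all_boot all_order all_algebra.
From mathcomp Require Import classical_sets reals.
From mathcomp Require Import ring lra.

Import Order.TTheory GRing.Theory Num.Theory.

Local Open Scope ring_scope.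

(** Arbitrary weights are allowed because those left after peeling off a block no longer sum to
    1. *)
Definition out_square_sum (R : realType) (m : nat) (f : 'I_m -> R) : R :=
  \sum_u f u * (\sum_(v | digon_chain u v) f v) ^+ 2.

Lemma lagrangian_poly_star (R : realType) (m : nat)
    (x : {ffun color (palette_star m) -> R}) :
  @lagrangian_poly R (palette_star m) x = out_square_sum R m x.
Proof.
rewrite /lagrangian_poly /out_square_sum /=.
transitivity (\sum_(u : 'I_m) \sum_(v | digon_chain u v)
    \sum_(w | digon_chain u w) x v * x u * x w).
  (* Moving the middle color [u] inside [v] lets two pairings produce the shape [((v, u), w)] of a
     triple. *)
  rewrite (exchange_big_dep predT) //= pair_big_dep /= pair_big_dep /=.
  by apply: eq_big => [t|//]; rewrite !inE.
apply: eq_bigr => u _; rewrite expr2 mulr_suml mulr_sumr.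
by apply: eq_bigr => v _; rewrite !mulr_sumr; apply: eq_bigr => w _; ring.
Qed.

(** Each vertex of the first block sends arcs to its twin and to all later vertices, while no later
    vertex sends an arc back, so the tail keeps its own sum. *)
Lemma out_square_sum_rec (R : realType) (m : nat) (f : 'I_m.+2 -> R) :
  let a := f ord0 in
  let b := f (lift ord0 ord0) in
  let g := fun u => f (lift ord0 (lift ord0 u)) in
  let T := \sum_u g u in
  out_square_sum R m.+2 f =
    a * (b + T) ^+ 2 + b * (a + T) ^+ 2 + out_square_sum R m g.
Proof.
move=> a b g T.
rewrite /out_square_sum !big_ord_recl addrA; congr (_ * _ ^+ 2 + _ * _ ^+ 2 + _).
- by rewrite big_mkcond !big_ord_recl /= add0r.
- by rewrite big_mkcond !big_ord_recl /= add0r.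
apply: eq_bigr => u _; congr (_ * _ ^+ 2).
rewrite big_mkcond !big_ord_recl /= !add0r [RHS]big_mkcond.
apply: eq_bigr => v _; rewrite /digon_chain /=.
by rewrite eqSS ltnS !(inj_eq (@lift_inj _ _)).
Qed.

(** Peeling whole blocks preserves the parity of [m]; the base case 1 is the final singleton
    block. *)
Lemma nat_ind2 (P : nat -> Prop) :
  P 0 -> P 1 -> (forall n, P n -> P n.+2) -> forall n, P n.
Proof.
move=> P0 P1 PS n; suff [] : P n /\ P n.+1 by [].
by elim: n => [|n [Pn Pn1]]; split=> //; exact: PS.
Qed.

Lemma out_square_sum_le (R : realType) (m : nat) (f : 'I_m -> R) :
  (forall u, 0 <= f u) ->
  3 * out_square_sum R m f + \sum_u f u ^+ 3 <= (\sum_u f u) ^+ 3.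
Proof.
elim/nat_ind2: m f => [||m IHm] f f_ge0.
- by rewrite /out_square_sum !big_ord0; lra.
- by rewrite /out_square_sum !big_ord1 big_pred0 => [|v]; [lra | rewrite !ord1].
rewrite out_square_sum_rec !big_ord_recl.
have := IHm _ (fun u => f_ge0 (lift ord0 (lift ord0 u))).
set L := out_square_sum _ _ _; set C := \sum_u _ ^+ 3; set T := \sum_u _.
have T_ge0 : 0 <= T by exact: sumr_ge0.
set a := f ord0; set b := f _.
have := mulr_ge0 T_ge0 (sqr_ge0 (a - b)); lra.
Qed.

(** With [a = b] in every block, the loss term [3 T (a - b)^2] vanishes. *)
Lemma out_square_sum_const (R : realType) (m : nat) (c : R) :
  3 * out_square_sum R m (fun=> c) + m%:R * c ^+ 3 = (m%:R * c) ^+ 3.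
Proof.
elim/nat_ind2: m => [||m IHm].
- by rewrite /out_square_sum big_ord0; ring.
- by rewrite /out_square_sum big_ord1 big_pred0 => [|v]; [ring | rewrite !ord1].
rewrite out_square_sum_rec sumr_const card_ord -mulr_natl -(addn2 m) natrD.
by move: IHm; set L := out_square_sum _ _ _; lra.
Qed.

(** The exact remainder is kept, rather than only its sign, because its vanishing will force
    uniqueness. *)
Lemma cube_tangent (R : realType) (x c : R) :
  x ^+ 3 = c ^+ 3 + 3 * c ^+ 2 * (x - c) + (x - c) ^+ 2 * (x + 2 * c).
Proof. ring. Qed.

Section ProbabilityVectors.
Variables (R : realType) (m : nat).
Hypothesis m_gt0 : (0 < m)%N.
Implicit Types x : {ffun 'I_m -> R}.

Let c : R := 1 / m%:R.
Let c_gt0 : 0 < c. Proof. by rewrite divr_gt0 // ltr0n. Qed.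
Let mc : m%:R * c = 1.
Proof. by rewrite /c mulrC divfK // pnatr_eq0 -lt0n. Qed.

(** The linear terms cancel since the deviations [x i - c] sum to 0, and [m c^3 = c^2]. *)
Lemma sum_cubes_prob x : \sum_i x i = 1 ->
  \sum_i x i ^+ 3 = c ^+ 2 + \sum_i (x i - c) ^+ 2 * (x i + 2 * c).
Proof.
move=> x1; under eq_bigr do rewrite (cube_tangent _ _ c).
rewrite !big_split /= -[X in _ + X + _]mulr_sumr big_split /= x1.
rewrite !sumr_const card_ord -(mulr_natl (c ^+ 3)) -(mulr_natl (- c)) mulrN.
by rewrite exprS mulrA mc mul1r subrr mulr0 addr0.
Qed.

Lemma lagrangian_poly_prob_le x : prob_vector x ->
  3 * @lagrangian_poly R (palette_star m) x
    + \sum_i (x i - c) ^+ 2 * (x i + 2 * c) <= 1 - c ^+ 2.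
Proof.
move=> [x1 x01].
have := @out_square_sum_le R m x (fun u => proj1 (andP (x01 u))).
by rewrite lagrangian_poly_star x1 (sum_cubes_prob _ x1); lra.
Qed.

Lemma deviation_ge0 x i : prob_vector x ->
  0 <= (x i - c) ^+ 2 * (x i + 2 * c).
Proof.
move=> [_ /(_ i) /andP[xi_ge0 _]]; rewrite mulr_ge0 ?sqr_ge0 //.
by have := c_gt0; lra.
Qed.

Lemma prob_vector_uniform : prob_vector ([ffun => c] : {ffun 'I_m -> R}).
Proof.
split=> [|i].
  by under eq_bigr do rewrite ffunE; rewrite sumr_const card_ord -mulr_natl.
by rewrite ffunE (ltW c_gt0) /c ler_pdivrMr ?ltr0n // mul1r ler1n.
Qed.

Lemma lagrangian_poly_uniform :
  3 * @lagrangian_poly R (palette_star m) [ffun => c] = 1 - c ^+ 2.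
Proof.
have := out_square_sum_const R m c.
have -> : out_square_sum R m (fun=> c)
    = @lagrangian_poly R (palette_star m) [ffun => c].
  rewrite lagrangian_poly_star; apply: eq_bigr => u _; rewrite ffunE.
  by congr (_ * _ ^+ 2); apply: eq_bigr => v _; rewrite ffunE.
by rewrite exprS mulrA mc; lra.
Qed.

Lemma lagrangian_poly_le_uniform x : prob_vector x ->
  @lagrangian_poly R (palette_star m) x
    <= @lagrangian_poly R (palette_star m) [ffun => c].
Proof.
move=> xP; have := lagrangian_poly_prob_le _ xP; have := lagrangian_poly_uniform.
have : 0 <= \sum_i (x i - c) ^+ 2 * (x i + 2 * c).
  by apply: sumr_ge0 => i _; exact: deviation_ge0.
lra.
Qed.

Lemma lagrangian_poly_eq_uniform x : prob_vector x ->
  @lagrangian_poly R (palette_star m) [ffun => c]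
    <= @lagrangian_poly R (palette_star m) x ->
  x = [ffun => c].
Proof.
move=> xP; have := lagrangian_poly_prob_le _ xP; have := lagrangian_poly_uniform.
set D := \sum_i _ => eqc lex lec.
have D0 : D = 0.
  apply/eqP; rewrite eq_le sumr_ge0 ?andbT => [|i _]; last exact: deviation_ge0.
  by lra.
apply/ffunP => i; rewrite ffunE; apply/eqP; rewrite -subr_eq0.
(* Every nonnegative summand of [D] is 0, and its factor [x i + 2 c] is positive, so [x i = c]. *)
move/psumr_eq0P: D0 => /(_ (fun i _ => deviation_ge0 x i xP) i isT)/eqP.
have /andP[xi_ge0 _] := xP.2 i.
by rewrite mulf_eq0 sqrf_eq0 => /orP[//|]; rewrite gt_eqF //; have := c_gt0; lra.
Qed.

End ProbabilityVectors.

Theorem theorem8p2 (R : realType) (m : nat) (hm : (2 <= m)%N) :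
  lagrangian R (palette_star m) = 1 / 3 - 1 / (3 * m%:R ^+ 2) /\
  (forall x : {ffun color (palette_star m) -> R},
     is_maximizer x <-> x = [ffun => 1 / m%:R]).
Proof.
have m_gt0 : (0 < m)%N by exact: ltnW.
have unifP := prob_vector_uniform R m m_gt0.
have unif_max := lagrangian_poly_le_uniform R m m_gt0.
split; last first.
  move=> x; split=> [[xP xmax]|->]; last by split.
  by apply: lagrangian_poly_eq_uniform => //; exact: xmax.
have -> : 1 / 3 - 1 / (3 * m%:R ^+ 2)
    = @lagrangian_poly R (palette_star m) [ffun => 1 / m%:R].
  have m_neq0 : m%:R != 0 :> R by rewrite pnatr_eq0 -lt0n.
  apply: (@mulfI _ 3); first by rewrite pnatr_eq0.
  by rewrite lagrangian_poly_uniform //; field.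
(* The value at the uniform vector is a maximum, and two maxima of a set bound each other, so the
   default 0 is never reached. *)
rewrite /lagrangian; apply: xget_unique.
  split; first by exists [ffun => 1 / m%:R].
  by move=> _ [x xP <-]; exact: unif_max.
move=> v [[x xP <-] xmax]; apply/eqP; rewrite eq_le unif_max //=.
by apply: xmax; exists [ffun => 1 / m%:R].
Qed.
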